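(* The condition $$\sqrt{A_n^2+B_n^2}<2n\left(F(\infty)-F(-\infty)\right)+2\left(g(\infty)-g(-\infty)\right) \qquad (\ast)$$ is not sufficient for the existence of a $2\pi$-periodic solution of $$x''+f(x)x'+g(x)+n^2x=e(t).$$ That is, there exist an integer $n\ge 1$, a function $e\in C(\mathbb{R})$ with $e(t+2\pi)=e(t)$ for all $t$, and functions $f,g\in C(\mathbb{R})$ such that, with $F(x)=\int_0^x f(z)\,dz$, the finite limits $F(\pm\infty)=\lim_{x\to\pm\infty}F(x)$ and $g(\pm\infty)=\lim_{x\to\pm\infty}g(x)$ exist, the inequalities $F(-\infty)<F(x)<F(\infty)$ and $g(-\infty)<g(x)<g(\infty)$ hold for all $x\in\mathbb{R}$, and condition $(\ast)$ holds, but the equation has no $2\pi$-periodic solution.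
   Context: Here $A_n=\int_0^{2\pi}e(t)\cos nt\,dt$ and $B_n=\int_0^{2\pi}e(t)\sin nt\,dt$. Solutions are classical: $x=x(t)$ is a $C^2$ real-valued function of $t\in\mathbb{R}$. *)

(* Defs.v *)
(* Stdlib reals with Coquelicot. *)
From Stdlib Require Import Reals.
From Coquelicot Require Import Coquelicot.
Open Scope R_scope.

Definition continuous_on_R (h : R -> R) : Prop := forall t : R, continuous h t.

Definition periodic_2PI (h : R -> R) : Prop := forall t : R, h (t + 2 * PI) = h t.

(* [Derive] is total, so differentiability is required explicitly. *)
Definition C2 (x : R -> R) : Prop :=
  (forall t : R, ex_derive x t) /\
  (forall t : R, ex_derive (Derive x) t) /\
  continuous_on_R (Derive (Derive x)).

Definition antideriv (f : R -> R) (x : R) : R := RInt f 0 x.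

Definition coefA (e : R -> R) (n : nat) : R :=
  RInt (fun t => e t * cos (INR n * t)) 0 (2 * PI).

Definition coefB (e : R -> R) (n : nat) : R :=
  RInt (fun t => e t * sin (INR n * t)) 0 (2 * PI).

Definition is_solution (n : nat) (e f g x : R -> R) : Prop :=
  C2 x /\
  forall t : R,
    Derive (Derive x) t + f (x t) * Derive x t + g (x t) + INR n ^ 2 * x t = e t.

(* Main.v *)
(** Take [g = atan] and [f] its derivative, so that [F = g], and
    [e t = 2 * H * cos t] with [H = PI / 2] and [n = 1].  Testing the equation
    against [cos] gives [2 * PI * H = \int g(x(t)) (cos t + sin t) dt] for a
    periodic solution [x], whereas the right-hand side is smaller than
    [H * \int |cos + sin| <= 2 * PI * H] (Cauchy-Schwarz).  The condition on
    the Fourier coefficients only asks for [2 * PI * H < 8 * H], i.e. [PI < 4]. *)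
Require Import Defs.
From Stdlib Require Import Reals Lra Lia.
From Coquelicot Require Import Coquelicot.
Open Scope R_scope.

(** The Leibniz series gives [PI / 4 <= 1 - 1/3 + 1/5]; index 0 would only yield [PI <= 4], and the
    inequality must be strict. *)
Lemma PI_lt_4 : PI < 4.
Proof.
destruct (PI_ineq 1) as [_ H].
unfold tg_alt, PI_tg in H; simpl in H; lra.
Qed.

Lemma is_lim_atan_p : is_lim atan p_infty (PI / 2).
Proof.
apply is_lim_spec; intros eps.
pose proof (cond_pos eps) as He; pose proof PI_RGT_0 as HPI.
(* The cutoff at 0 keeps [a] in the range where [atan] inverts [tan], even for large [eps]. *)
set (a := Rmax 0 (PI / 2 - eps)).
assert (Ha : 0 <= a < PI / 2 /\ PI / 2 - eps <= a).
{ unfold a, Rmax; destruct Rle_dec; lra. }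
exists (tan a); intros y Hy.
apply atan_increasing in Hy; rewrite atan_tan in Hy by lra.
pose proof (atan_bound y).
apply Rabs_def1; lra.
Qed.

Lemma is_lim_atan_m : is_lim atan m_infty (- (PI / 2)).
Proof.
apply is_lim_ext with (fun y => - atan (- y)).
{ intros y; rewrite atan_opp; ring. }
apply (is_lim_opp (fun y => atan (- y)) m_infty (PI / 2)).
apply is_lim_comp with p_infty.
- exact is_lim_atan_p.
- apply (is_lim_opp (fun y => y) m_infty m_infty), is_lim_id.
- now exists 0.
Qed.

Lemma continuous_datan (y : R) : continuous (fun z => / (1 + z²)) y.
Proof.
apply (ex_derive_continuous (fun z => / (1 + z²))).
pose proof (Rle_0_sqr y); unfold Rsqr in *; auto_derive; lra.
Qed.

Lemma antideriv_datan (y : R) : antideriv (fun z => / (1 + z²)) y = atan y.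
Proof.
unfold antideriv; apply is_RInt_unique.
replace (atan y) with (minus (atan y) (atan 0)).
- apply (is_RInt_derive atan); intros z _;
    [apply is_derive_atan | apply continuous_datan].
- rewrite atan_0; unfold minus, plus, opp; simpl; ring.
Qed.

Lemma coefA_cos (c : R) : coefA (fun t => c * cos t) 1 = c * PI.
Proof.
unfold coefA; apply is_RInt_unique.
set (P := fun t => c * (t + sin t * cos t) / 2).
replace (c * PI) with (minus (P (2 * PI)) (P 0)).
- apply (is_RInt_derive P); intros t _.
  + unfold P; auto_derive; [easy|].
    simpl INR; rewrite (Rmult_1_l t).
    pose proof (sin2_cos2 t) as Hsc; unfold Rsqr in Hsc.
    replace (1 + (1 * cos t * cos t + sin t * (1 * - sin t)))
      with (2 * (cos t * cos t)) by lra.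
    field.
  + apply (ex_derive_continuous (fun t => c * cos t * cos (INR 1 * t))).
    now auto_derive.
- unfold P, minus, plus, opp; simpl; rewrite sin_2PI, sin_0; field.
Qed.

Lemma coefB_cos (c : R) : coefB (fun t => c * cos t) 1 = 0.
Proof.
unfold coefB; apply is_RInt_unique.
set (P := fun t => c * (sin t * sin t) / 2).
replace 0 with (minus (P (2 * PI)) (P 0)) at 2.
- apply (is_RInt_derive P); intros t _.
  + unfold P; auto_derive; [easy|].
    simpl INR; rewrite (Rmult_1_l t); field.
  + apply (ex_derive_continuous (fun t => c * cos t * sin (INR 1 * t))).
    now auto_derive.
- unfold P, minus, plus, opp; simpl; rewrite sin_2PI, sin_0; field.
Qed.

(** The difference quotients at [t + 2 * PI] and at [t] agree term by term along the sequence whose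
    limit defines [Derive]. *)
Lemma Derive_periodic (x : R -> R) :
  periodic_2PI x -> periodic_2PI (Derive x).
Proof.
intros Hp t; unfold Derive, Lim; f_equal; apply Lim_seq_ext; intros n.
replace (t + 2 * PI + Rbar_loc_seq 0 n) with (t + Rbar_loc_seq 0 n + 2 * PI)
  by ring.
now rewrite !Hp.
Qed.

(** The testing against [cos] is done without integrals: a periodic solution would make a certain
    function both strictly increasing and equal at 0 and [2 * PI]. *)
Lemma no_periodic_solution (H : R) (h f : R -> R) :
  (forall y, is_derive h y (f y)) ->
  (forall y, - H < h y < H) ->
  ~ (exists x, is_solution 1 (fun t => 2 * H * cos t) f h x /\ periodic_2PI x).
Proof.
intros Hder Hbd [x [[[Hx [Hx' _]] Heq] Hper]].
(* The first three terms have derivative [e cos - h(x) (cos + sin)]; the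
   pointwise bound [2 H h u <= h^2 + H^2 u^2 < H^2 (1 + u^2)], with
   [u = cos + sin], makes it exceed that of the subtracted periodic term. *)
set (Psi := fun t => Derive x t * cos t + x t * sin t + h (x t) * cos t
                     - H * (sin t * cos t - sin t * sin t / 2)).
set (dPsi := fun t => 2 * H * cos t * cos t - h (x t) * (cos t + sin t)
                      - H * (cos t * cos t - sin t * sin t - sin t * cos t)).
assert (Hd : forall t, is_derive Psi t (dPsi t)).
{ intros t; unfold Psi, dPsi; auto_derive.
  - repeat split; auto. now exists (f (x t)).
  - replace (Derive (fun y => h y) (x t)) with (f (x t))
      by (symmetry; apply is_derive_unique, Hder).
    change (fun y => Derive (fun z => x z) y) with (Derive x).
    specialize (Heq t); simpl INR in Heq.
    change (Derive (fun y => x y) t) with (Derive x t).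
    change (Derive (fun y => Derive x y) t) with (Derive (Derive x) t).
    replace (Derive (Derive x) t)
      with (2 * H * cos t - f (x t) * Derive x t - h (x t) - x t) by lra.
    field. }
assert (Hpos : forall t, dPsi t > 0).
{ intros t; unfold dPsi.
  pose proof (Hbd (x t)) as Hb.
  pose proof (sin2_cos2 t) as Hsc; unfold Rsqr in Hsc.
  set (c := cos t) in *; set (s := sin t) in *; set (k := h (x t)) in *.
  assert (HH : 0 < H) by lra.
  assert (Hk : k * k < H * H) by nra.
  (* Completing the square: [2 * H * dPsi t] equals [H^2 - k^2 + (k - H * (c + s))^2]. *)
  pose proof (Rle_0_sqr (k - H * (c + s))) as Hsq; unfold Rsqr in Hsq.
  apply Rmult_lt_reg_l with (2 * H); [lra|].
  replace (2 * H * (2 * H * c * c - k * (c + s) - H * (c * c - s * s - s * c)))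
    with (H * H * (s * s + c * c) - k * k
          + (k - H * (c + s)) * (k - H * (c + s))) by ring.
  rewrite Hsc; lra. }
assert (Hlt : Psi 0 < Psi (2 * PI)).
{ pose proof PI_RGT_0.
  apply (incr_function Psi m_infty p_infty dPsi); simpl; auto; lra. }
(* By periodicity both endpoint values of [Psi] are [Derive x 0 + h (x 0)]. *)
pose proof (Hper 0) as H0; pose proof (Derive_periodic x Hper 0) as H1.
rewrite Rplus_0_l in H0, H1.
unfold Psi in Hlt; rewrite H0, H1, cos_2PI, sin_2PI, cos_0, sin_0 in Hlt.
lra.
Qed.

Theorem proposition2 :
  exists (n : nat) (e f g : R -> R),
    (1 <= n)%nat /\
    continuous_on_R e /\ periodic_2PI e /\
    continuous_on_R f /\ continuous_on_R g /\
    exists Fminf Fpinf gminf gpinf : R,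
      is_lim (antideriv f) m_infty (Finite Fminf) /\
      is_lim (antideriv f) p_infty (Finite Fpinf) /\
      is_lim g m_infty (Finite gminf) /\
      is_lim g p_infty (Finite gpinf) /\
      (forall x : R, Fminf < antideriv f x < Fpinf) /\
      (forall x : R, gminf < g x < gpinf) /\
      sqrt (coefA e n ^ 2 + coefB e n ^ 2)
        < 2 * INR n * (Fpinf - Fminf) + 2 * (gpinf - gminf) /\
      ~ (exists x : R -> R, is_solution n e f g x /\ periodic_2PI x).
Proof.
(* The amplitude stays unsimplified to match [no_periodic_solution] with [H := PI / 2]. *)
exists 1%nat, (fun t => 2 * (PI / 2) * cos t), (fun y => / (1 + y²)), atan.
assert (Hatan : forall y, - (PI / 2) < atan y < PI / 2).
{ intros y; pose proof (atan_bound y); lra. }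
split; [lia|].
split.
{ intros t; apply (ex_derive_continuous (fun t => 2 * (PI / 2) * cos t)).
  now auto_derive. }
split.
{ intros t; now rewrite cos_plus, cos_2PI, sin_2PI, Rmult_1_r, Rmult_0_r, Rminus_0_r. }
split; [exact continuous_datan|].
split.
{ intros y; apply (ex_derive_continuous atan).
  eexists; apply is_derive_atan. }
exists (- (PI / 2)), (PI / 2), (- (PI / 2)), (PI / 2).
split.
{ apply is_lim_ext with atan; [|exact is_lim_atan_m].
  intros y; now rewrite antideriv_datan. }
split.
{ apply is_lim_ext with atan; [|exact is_lim_atan_p].
  intros y; now rewrite antideriv_datan. }
split; [exact is_lim_atan_m|].
split; [exact is_lim_atan_p|].
split; [intros y; now rewrite antideriv_datan|].
split; [exact Hatan|].
split.
- rewrite coefA_cos, coefB_cos; simpl INR.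
  (* Both jumps equal [PI], so the claim reduces to [PI * PI < 4 * PI]. *)
  pose proof PI_RGT_0; pose proof PI_lt_4.
  replace ((2 * (PI / 2) * PI) ^ 2 + 0 ^ 2) with ((PI * PI) ^ 2) by field.
  rewrite sqrt_pow2; nra.
- apply no_periodic_solution; [exact is_derive_atan | exact Hatan].
Qed.
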